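(* Let $n>11$ be an integer and let $k$ be a positive integer. Then $\mathbb{Z}_n$ is not $k$-index stable if and only if $2\leq k\leq\lfloor\frac{n}{3}\rfloor$.
   Context: $\mathbb{Z}_n=\{0,1,\ldots,n-1\}$ is the group of least nonnegative residues modulo $n$ under addition modulo $n$; sums and differences of elements and subsets are taken in this group, so $A-A=\{a-a' : a,a'\in A\}$, etc. Let $A$ be a non-empty subset of $\mathbb{Z}_n$. A subset $B\subseteq\mathbb{Z}_n$ is called a subfactor of $\mathbb{Z}_n$ relative to $A$ if $(A-A)\cap(B-B)=\{0\}$ and $(A-A)+B=\mathbb{Z}_n$. The lower subindex $|\mathbb{Z}_n:A|^-$ (resp. upper subindex $|\mathbb{Z}_n:A|^+$) is the minimum (resp. maximum) of $|B|$ over all subfactors $B$ of $\mathbb{Z}_n$ relative to $A$. The set $A$ is called index stable (in $\mathbb{Z}_n$) if $|\mathbb{Z}_n:A|^-=|\mathbb{Z}_n:A|^+$. The group $\mathbb{Z}_n$ is called $k$-index stable if all subsets of $\mathbb{Z}_n$ of size $k$ are index stable. *)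

(* Defs.v *)
From HB Require Import structures.
From mathcomp Require Import all_boot all_order all_algebra.

Set Implicit Arguments.
Unset Strict Implicit.
Unset Printing Implicit Defensive.

Import GRing.Theory.
Local Open Scope ring_scope.

Section Subindex.

Variable G : finZmodType.
Implicit Types A B : {set G}.

Definition sumset A B : {set G} := [set a + b | a in A, b in B].

Definition diffset A B : {set G} := [set a - b | a in A, b in B].

Definition subfactor A B : bool :=
  (diffset A A :&: diffset B B == [set 0]) &&
  (sumset (diffset A A) B == [set: G]).

(* The neutral element #|G| never affects the minimum, because #|B| <= #|G|
   and a subfactor exists whenever A is non-empty; see lower_subindexP. *)
Definition lower_subindex A : nat :=
  \big[minn/#|G|]_(B : {set G} | subfactor A B) #|B|.

Definition upper_subindex A : nat :=
  \max_(B : {set G} | subfactor A B) #|B|.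

Definition index_stable A : Prop := lower_subindex A = upper_subindex A.

Lemma subfactor_exists A : A != set0 -> exists B, subfactor A B.
Proof.
case/set0Pn=> a aA.
have D0 : 0 \in diffset A A by apply/imset2P; exists a a; rewrite ?subrr.
have DN x : x \in diffset A A -> - x \in diffset A A.
  case/imset2P=> u v uA vA ->; rewrite opprB.
  by apply/imset2P; exists v u.
pose P B := diffset A A :&: diffset B B == [set 0].
have P0 : P [set 0].
  apply/eqP/setP=> x; rewrite !inE; apply/andP/eqP => [[_]|->].
    by case/imset2P=> u v /set1P-> /set1P->; rewrite subrr.
  by split=> //; apply/imset2P; exists 0 0; rewrite ?inE ?subrr.
have [B /maxsetP[PB maxB] B0] := maxset_exists P0.
exists B; rewrite /subfactor (PB : _ == _) /=.
apply/eqP/setP=> x; rewrite inE; apply/negPn/negP=> xND.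
suff /maxB /(_ (subsetUr _ _)) eqB : P (x |: B).
  case/negP: xND; apply/imset2P; exists 0 x; rewrite ?add0r //.
  by rewrite -eqB setU11.
have xNB b : b \in B -> x - b \in diffset A A -> False.
  move=> bB xb; case/negP: xND; apply/imset2P.
  by exists (x - b) b; rewrite ?subrK.
apply/eqP/setP=> y; rewrite !inE; apply/andP/eqP => [[yA]|->]; last first.
  by split=> //; apply/imset2P; exists x x; rewrite ?setU11 ?subrr.
case/imset2P=> u v /setU1P[->|uB] /setU1P[->|vB] Dy; rewrite Dy ?subrr //.
- by case: (xNB v vB); rewrite -Dy.
- by case: (xNB u uB); rewrite -opprB -Dy DN.
apply/set1P; rewrite -(eqP (PB : _ == _)) inE -Dy yA Dy.
by apply/imset2P; exists u v.
Qed.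

Lemma lower_subindexP A : A != set0 ->
  (exists2 B, subfactor A B & #|B| = lower_subindex A) /\
  (forall B, subfactor A B -> lower_subindex A <= #|B|)%N.
Proof.
move=> /subfactor_exists[B0 sB0].
case: (arg_minnP (fun B : {set G} => #|B|) sB0) => B sB minB.
suff -> : lower_subindex A = #|B| by split=> //; exists B.
apply/eqP; rewrite eqn_leq; apply/andP; split.
  rewrite /lower_subindex; have := mem_index_enum B.
  elim: (index_enum _) => // C r IHr; rewrite inE big_cons.
  case/predU1P=> [<-|/IHr le_r]; first by rewrite sB geq_minl.
  by case: ifP => // _; rewrite geq_min le_r orbT.
rewrite /lower_subindex; elim/big_rec: _ => [|C m sC le_m].
  exact: max_card.
by rewrite leq_min minB.
Qed.

Lemma upper_subindexP A : A != set0 ->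
  (exists2 B, subfactor A B & #|B| = upper_subindex A) /\
  (forall B, subfactor A B -> #|B| <= upper_subindex A)%N.
Proof.
move=> /subfactor_exists[B0 sB0].
have [B sB eqB] := eq_bigmax_cond (fun B : {set G} => #|B|)
  (introT card_gt0P (ex_intro _ B0 sB0)).
split; first by exists B.
by move=> C sC; apply: leq_bigmax_cond.
Qed.

End Subindex.

Definition group_index_stable (G : finZmodType) (k : nat) : Prop :=
  forall A : {set G}, #|A| = k -> index_stable A.

(* Main.v *)
Require Import Defs.
From mathcomp Require Import all_boot all_order all_algebra.
From mathcomp Require Import zify.

(** A subfactor relative to [A] is a maximal independent set of the Cayley
    graph of the group with connection set [A - A].  Since [A + B] is a direct
    sum, [|A| |B| <= n]; so [3 |A| > n] leaves only the sizes 1 and 2, and 1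
    occurs only if [A - A] is the whole group, in which case it is the only size.
    If [A - A = [-m, m]], a subfactor is a cyclic sequence whose gaps all lie in
    [[m+1, 2m+1]]; spreading [c] points evenly produces one of size [c] as soon
    as [c (m+1) <= n <= c (2m+1)].  For [2 <= k <= n/3] the interval
    [{0, ..., k-1}] (with [m = k-1]) admits both [c = n/k] and [c = n/k - 1],
    unless [n = 4k-1]; then [{0, ..., k-2, k}] (with [m = k]) admits
    [c = 3] and [c = 2]. *)

Set Implicit Arguments.
Unset Strict Implicit.

Import GRing.Theory.
Local Open Scope ring_scope.

Section Subfactors.

Variable G : finZmodType.
Implicit Types A B : {set G}.

Lemma mem_diffset A a b : a \in A -> b \in A -> a - b \in diffset A A.
Proof. by move=> aA bA; apply/imset2P; exists a b. Qed.

Lemma subfactor_diff0 A B x : subfactor A B ->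
  x \in diffset A A -> x \in diffset B B -> x = 0.
Proof.
case/andP=> /eqP/setP/(_ x); rewrite !inE => Dx _ xA xB.
by apply/eqP; rewrite -Dx xA xB.
Qed.

Lemma subfactor_cover A B x : subfactor A B ->
  exists2 b, b \in B & x - b \in diffset A A.
Proof.
case/andP=> _ /eqP/setP/(_ x); rewrite inE => /imset2P[d b dD bB ->].
by exists b; rewrite ?addrK.
Qed.

(** Addition is injective on pairs from [A] and [B]: a collision puts [a - a' = b' - b] in both
    difference sets, so it vanishes. *)
Lemma subfactor_card_mul A B : subfactor A B -> (#|A| * #|B| <= #|G|)%N.
Proof.
move=> sB; rewrite -cardsX -(card_in_imset (f := fun p : G * G => p.1 + p.2)).
  exact: max_card.
move=> [a b] [a' b'] /setXP[/= aA bB] /setXP[/= aA' bB'] E.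
have Eab : a - a' = b' - b.
  by apply/eqP; rewrite subr_eq addrAC eq_sym subr_eq addrC -E.
have a0 : a - a' = 0.
  by apply: (subfactor_diff0 sB); [|rewrite Eab]; apply: mem_diffset.
by move: a0 (a0); rewrite {1}Eab => /subr0_eq-> /subr0_eq->.
Qed.

Lemma index_stableP A : A != set0 ->
  index_stable A <->
  (forall B B', subfactor A B -> subfactor A B' -> #|B| = #|B'|).
Proof.
move=> A0; have [[L sL DL] minL] := lower_subindexP A0.
have [[U sU DU] maxU] := upper_subindexP A0.
split=> [E B B' sB sB' | E]; last by rewrite /index_stable -DL -DU; apply: E.
move: (minL B sB) (minL B' sB') (maxU B sB) (maxU B' sB').
rewrite /index_stable in E; lia.
Qed.

Lemma index_stable1 A : #|A| = 1%N -> index_stable A.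
Proof.
move=> /eqP/cards1P[a ->].
have full B : subfactor [set a] B -> B = setT.
  move=> sB; apply/setP=> x; rewrite inE.
  have [b bB /imset2P[u v /set1P-> /set1P->]] := subfactor_cover x sB.
  by rewrite subrr => /subr0_eq->.
apply/index_stableP; first by apply/set0Pn; exists a; rewrite inE.
by move=> B B' /full-> /full->.
Qed.

Lemma index_stable_large A : (#|G| < 3 * #|A|)%N -> index_stable A.
Proof.
move=> ltA; have A0 : A != set0 by rewrite -card_gt0; lia.
suff card_sub B : subfactor A B -> #|B| = (diffset A A != setT).+1.
  by apply/(index_stableP A0) => B B' /card_sub-> /card_sub->.
move=> sB; have [b bB _] := subfactor_cover 0 sB.
case: eqP => [DT | DnT] /=.
  apply/eqP/cards1P; exists b; apply/setP=> x; rewrite inE.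
  apply/idP/eqP=> [xB | ->//]; apply: subr0_eq.
  by apply: (subfactor_diff0 sB); rewrite ?DT ?inE ?mem_diffset.
(* The product bound leaves only sizes 1 and 2; a singleton [B] would make a translate of [A - A],
   hence [A - A], the whole group. *)
have := subfactor_card_mul sB.
suff : #|B| != 1%N.
  have : (0 < #|B|)%N by apply/card_gt0P; exists b.
  by case: #|B| => [|[|[|c]]] //; nia.
apply/cards1P=> -[b' DB]; case: DnT; apply/setP=> x; rewrite inE.
have [b'' ] := subfactor_cover (x + b') sB.
by rewrite DB inE => /eqP->; rewrite addrK.
Qed.

End Subfactors.


(** Take the floors of [i * n / c]: the exact step [n / c] lies between the integers [m + 1] and
    [2m + 1], and rounding down preserves both bounds. *)
Lemma even_spread n c m : (0 < c)%N -> (c * m.+1 <= n <= c * (2 * m).+1)%N ->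
  exists p : nat -> nat, [/\ p 0%N = 0%N, p c = n,
    forall i j, (i < j -> p i + m < p j)%N &
    forall i, (p i.+1 <= p i + (2 * m).+1)%N].
Proof.
move=> c_gt0 /andP[le_n ge_n]; exists (fun i => (i * n %/ c)%N).
split=> [||i j ltij|i]; first by rewrite mul0n div0n.
- by rewrite mulKn.
- rewrite -addnS addnC -divnMDl //; apply: leq_div2r; nia.
- rewrite addnC -divnMDl //; apply: leq_div2r; nia.
Qed.

Lemma between_steps (p : nat -> nat) x c : (p 0 <= x < p c)%N ->
  exists2 i, (i < c)%N & (p i <= x < p i.+1)%N.
Proof.
case/andP=> le0x; elim: c => [|c IHc ltx]; first by lia.
have [/IHc[i ltic px] | lexc] := ltnP x (p c); first by exists i => //; lia.
by exists c; rewrite ?lexc.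
Qed.

Lemma natr_Zp_eq n (a b : nat) : (1 < n)%N ->
  a%:R = b%:R :> 'Z_n -> a = b %[mod n].
Proof. by move=> n_gt1 /(congr1 val) /=; rewrite !val_Zp_nat. Qed.

(** The difference [(b + r) - (a + q)] lies strictly between 0 and [n]. *)
Lemma modn_far n m a b q r : (a <= m)%N -> (b <= m)%N ->
  (q + m < r)%N -> (r + m < q + n)%N -> a + q <> b + r %[mod n].
Proof.
move=> lea leb ltq ltr /esym/eqP; rewrite eqn_mod_dvd; last by lia.
by move/dvdn_leq=> /(_ ltac:(lia)); lia.
Qed.

Section Circulant.

(** [f_le] and [f_diff] together make [A - A] exactly the set of residues of [[-m, m]]. *)
Variables (n m k : nat) (f : 'I_k -> nat).
Hypotheses (n_gt1 : (1 < n)%N) (f_inj : injective f).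
Hypotheses (f_le : forall i, (f i <= m)%N)
  (f_diff : forall t, (t <= m)%N -> exists i j, f i = (f j + t)%N).

Let A : {set 'Z_n} := [set (f i)%:R | i : 'I_k].

Let fA i : (f i)%:R \in A. Proof. exact: imset_f. Qed.

Lemma card_natr_image : (m < n)%N -> #|A| = k.
Proof.
move=> lt_mn; rewrite card_imset ?card_ord // => i j /(natr_Zp_eq n_gt1).
by rewrite !modn_small ?(leq_ltn_trans (f_le _)) //; apply: f_inj.
Qed.

Lemma circulant_subfactor c : (0 < c)%N ->
  (c * m.+1 <= n <= c * (2 * m).+1)%N ->
  exists2 B, subfactor A B & #|B| = c.
Proof.
move=> c_gt0 cP; have [p [p0 pc p_gap p_step]] := even_spread c_gt0 cP.
(* The gap across the wrap-around is controlled by comparing with [p c = n]. Taking [u = v = 0]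
   gives the cardinality, [u] and [v] values of [f] the independence. *)
have p_far (i j : 'I_c) u v : (u <= m)%N -> (v <= m)%N ->
    u + p i = v + p j %[mod n] -> i = j.
  move=> leu lev E; apply: val_inj => /=.
  have := p_gap i c (ltn_ord i); have := p_gap j c (ltn_ord j).
  rewrite pc => ltj lti; have [/p_gap lt|/p_gap lt|//] := ltngtP i j.
    by case: (@modn_far n m u v (p i) (p j)); rewrite //; lia.
  by case: (@modn_far n m v u (p j) (p i)); rewrite //; lia.
exists [set (p i)%:R | i : 'I_c]; last first.
  rewrite card_imset ?card_ord // => i j /(natr_Zp_eq n_gt1).
  exact: (p_far i j 0 0).
apply/andP; split.
  apply/eqP/setP=> x; rewrite !inE; apply/andP/eqP=> [[]|->]; last first.
    split; last by apply/imset2P; exists 0 0; rewrite ?subrr //;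
      apply/imsetP; exists (Ordinal c_gt0); rewrite /= ?p0.
    have [i [j _]] := f_diff (leq0n m).
    by apply/imset2P; exists (f i)%:R (f i)%:R; rewrite ?subrr // fA.
  case/imset2P=> _ _ /imsetP[u _ ->] /imsetP[v _ ->] Dx.
  case/imset2P=> _ _ /imsetP[i _ ->] /imsetP[j _ ->] Dx'.
  suff Dij : i = j by rewrite Dx' Dij subrr.
  apply: (p_far i j (f v) (f u)) => //; apply: natr_Zp_eq => //.
  rewrite !natrD.
  have -> : (f u)%:R = x + (f v)%:R by rewrite Dx subrK.
  have -> : (p i)%:R = x + (p j)%:R by rewrite Dx' subrK.
  by rewrite addrCA addrA.
apply/eqP/setP=> x; rewrite inE.
have lt_xn : (x < n)%N by rewrite -[X in (_ < X)%N](Zp_cast n_gt1).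
have [i lt_ic /andP[le_px lt_xp]] : exists2 i, (i < c)%N & (p i <= x < p i.+1)%N.
  by apply: between_steps; rewrite p0 pc.
(* The index [c] is allowed: [p c = n] is congruent to [p 0], which serves the points of the last
   gap. *)
have pB j : (j <= c)%N -> ((p j)%:R : 'Z_n) \in [set (p i)%:R | i : 'I_c].
  rewrite leq_eqVlt => /predU1P[->|ltjc].
    apply/imsetP; exists (Ordinal c_gt0) => //=.
    by rewrite p0 pc pchar_Zp.
  by apply/imsetP; exists (Ordinal ltjc).
(* A gap is at most [2m + 1], so a point more than [m] above [p i] is at most [m] below [p i.+1]. *)
have [le_xm | lt_mx] := leqP x (p i + m).
  have [|u [v Duv]] := @f_diff (x - p i)%N; first by lia.
  apply/imset2P; exists ((f u)%:R - (f v)%:R) (p i)%:R.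
  - by rewrite mem_diffset ?fA.
  - by apply: pB; lia.
  by rewrite Duv natrD natrB // natr_Zp [(f v)%:R + _]addrC addrK subrK.
have [|u [v Duv]] := @f_diff (p i.+1 - x)%N; first by have := p_step i; lia.
apply/imset2P; exists ((f v)%:R - (f u)%:R) (p i.+1)%:R.
- by rewrite mem_diffset ?fA.
- exact: pB.
rewrite Duv natrD natrB 1?ltnW // natr_Zp.
by rewrite opprD addrA subrr add0r opprB subrK.
Qed.

Lemma circulant_nonstable c : (0 < k)%N -> (m < n)%N -> (1 < c)%N ->
  (c * m.+1 <= n)%N -> (n <= c.-1 * (2 * m).+1)%N ->
  ~ group_index_stable 'Z_n k.
Proof.
move=> k_gt0 lt_mn c_gt1 le_n ge_n /(_ _ (card_natr_image lt_mn)).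
have A0 : A != set0 by rewrite -card_gt0 card_natr_image.
have [||B sB DB] := @circulant_subfactor c; try nia.
have [||B' sB' DB'] := @circulant_subfactor c.-1; try nia.
by move/(index_stableP A0)/(_ B B' sB sB'); rewrite DB DB'; lia.
Qed.

End Circulant.

Lemma interval_nonstable n k c : (0 < k)%N -> (1 < c)%N -> (c * k <= n)%N ->
  (n <= c.-1 * (2 * k).-1)%N -> ~ group_index_stable 'Z_n k.
Proof.
case: k => // k _ c_gt1 le_n ge_n.
apply: (@circulant_nonstable n k k.+1 val _ _ _ _ c) => //; try nia.
- exact: val_inj.
- by move=> i; exact: (ltn_ord i).
move=> t le_tk; exists (Ordinal (le_tk : (t < k.+1)%N)), ord0.
by rewrite /= add0n.
Qed.

(** The bound [3 (k + 1) <= 4k - 1] holds exactly when [k > 3]. *)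
Lemma punctured_interval_nonstable k : (3 < k)%N ->
  ~ group_index_stable 'Z_(4 * k).-1 k.
Proof.
move=> k_gt3; pose f (i : 'I_k) : nat := if i == k.-1 :> nat then k else i.
apply: (@circulant_nonstable _ k k f _ _ _ _ 3) => //; try lia.
- move=> i j E; apply: val_inj; move: E (ltn_ord i) (ltn_ord j).
  by rewrite /f /=; do 2![case: eqP]; lia.
- by move=> i; have := ltn_ord i; rewrite /f; case: eqP; lia.
have lt_last : (k.-1 < k)%N by lia.
have lt_0 : (0 < k)%N by lia.
have lt_1 : (1 < k)%N by lia.
move=> t le_tk.
(* The differences are [k - 1], [k - 0] and, below [k - 1], [t - 0]. *)
have [Dt | [Dt | ltt]] : t = k.-1 \/ (t = k \/ t < k.-1)%N by lia.
- exists (Ordinal lt_last), (Ordinal lt_1).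
  by rewrite /f /=; do 2![case: eqP]; lia.
- exists (Ordinal lt_last), (Ordinal lt_0).
  by rewrite /f /=; do 2![case: eqP]; lia.
have ltk : (t < k)%N by lia.
exists (Ordinal ltk), (Ordinal lt_0).
by rewrite /f /=; do 2![case: eqP]; lia.
Qed.

Unset Implicit Arguments.

Theorem theorem2p5 (n k : nat) (hn : (11 < n)%N) (hk : (0 < k)%N) :
  ~ group_index_stable 'Z_n k <-> (2 <= k <= n %/ 3)%N.
Proof.
have cardZ : #|'Z_n| = n by rewrite card_ord Zp_cast //; lia.
split=> [nstable | /andP[k_gt1 le_k]].
  apply/negPn/negP=> k_out; apply: nstable => A cardA.
  have [k1 | k_large] : k = 1%N \/ (n < 3 * k)%N by lia.
    by apply: index_stable1; rewrite cardA.
  by apply: index_stable_large; rewrite cardZ cardA.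
(* Here [n > 11] forces [k > 3]. *)
have [Dn | n_ne] := eqVneq n (4 * k).-1.
  by rewrite Dn; apply: punctured_interval_nonstable; lia.
have Dq := divn_eq n k; have ltr : (n %% k < k)%N by rewrite ltn_mod.
have q_ge3 : (3 <= n %/ k)%N by rewrite leq_divRL //; lia.
(* With [n = q k + r], the upper bound reads [r + 1 <= (q - 2)(k - 1)]; for [q >= 3] and [k >= 2] it
   fails only if [q = 3] and [r = k - 1], that is [n = 4k - 1]. *)
apply: (@interval_nonstable n k (n %/ k)) => //; nia.
Qed.
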